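(* Let $R_\downarrow$ and $R_\uparrow$ be cumulative hazard functions such that, for some $x_0\in\mathbb{R}$, $R_\downarrow(x)\leq R_\uparrow(x)$ for all $x\geq x_0$, and let $\xi_1$ be an $R_\downarrow$-heavy random variable. Then the following are equivalent: (i) There exists, on a suitable probability space, an $R_\downarrow$-heavy random variable $\xi_2$, independent of $\xi_1$, such that $\eta:=\min(\xi_1,\xi_2)$ is $R_\uparrow$-light. (ii) There exist $\gamma>0$ and an $(R_\downarrow,R_\uparrow)$-segmentation $s_1<t_1<s_2<t_2<\cdots$ such that $$\frac{R_{\xi_1}(x)}{R_\uparrow(x)}\geq\gamma\qquad\text{for all }x\in[s_i,t_i],\ i=1,2,\dots.$$
   Context: A cumulative hazard function is a function $R:\mathbb{R}\to[0,\infty)$ that is nondecreasing, right-continuous, with $\lim_{x\to-\infty}R(x)=0$ and $\lim_{x\to\infty}R(x)=\infty$. For a real random variable $\xi$, its cumulative hazard is $R_\xi(x):=-\log\mathbb{P}(\xi>x)$. A random variable $\xi$ is right-unbounded if $\mathbb{P}(\xi>x)>0$ for all $x\in\mathbb{R}$. For a cumulative hazard function $R$, a right-unbounded random variable $\xi$ is $R$-heavy if $\liminf_{x\to\infty}R_\xi(x)/R(x)=0$, and $R$-light otherwise (i.e. if this liminf is positive). For $R_\downarrow,R_\uparrow$ as in the claim, an $(R_\downarrow,R_\uparrow)$-segmentation is a sequence of real numbers $s_1<t_1<s_2<t_2<\cdots$ such that $R_\downarrow(s_1)>1$ and $$\lim_{i\to\infty}\frac{R_\uparrow(s_i-0)}{R_\downarrow(t_i)}=0,$$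 where $R_\uparrow(s-0)$ denotes the left limit of $R_\uparrow$ at $s$. The inequality $R_{\xi_1}(x)/R_\uparrow(x)\geq\gamma$ is understood to include that the quotient is defined, i.e. $R_\uparrow(x)>0$. ''On a suitable probability space'' means that the underlying probability space may be replaced by another one carrying a copy of $\xi_1$ with the same distribution. *)

(* Defs.v *)
From mathcomp Require Import all_boot all_order all_algebra.
From mathcomp Require Import all_classical all_reals all_analysis measurable_realfun.

Set Implicit Arguments.
Unset Strict Implicit.
Unset Printing Implicit Defensive.

Import Order.TTheory GRing.Theory Num.Theory.
Import numFieldNormedType.Exports.

Local Open Scope classical_set_scope.
Local Open Scope ring_scope.

Record cumulative_hazard (R : realType) (H : R -> R) : Prop := CumulativeHazard {
  cumulative_hazard_ge0 : forall x, 0 <= H x ;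
  cumulative_hazard_nd : {homo H : x y / x <= y} ;
  cumulative_hazard_rc : right_continuous H ;
  cumulative_hazard_Ny : H x @[x --> -oo] --> (0 : R) ;
  cumulative_hazard_y : H x @[x --> +oo] --> +oo }.

(* Extended-real valued: equal to +oo at the points x where the tail
   probability of X vanishes. *)
Definition hazard (R : realType) (d : measure_display) (T : measurableType d)
  (P : probability T R) (X : {RV P >-> R}) (x : R) : \bar R :=
  (- lne (ccdf X x))%E.
Arguments hazard {R d T} P X x.

Definition right_unbounded (R : realType) (d : measure_display)
  (T : measurableType d) (P : probability T R) (X : {RV P >-> R}) : Prop :=
  forall x : R, (0 < P [set w | (x < X w)%R])%E.
Arguments right_unbounded {R d T} P X.

(* The division by zero that may occur for small x is irrelevant to the limit
   inferior, since H tends to +oo. *)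
Definition hazard_liminf (R : realType) (d : measure_display)
  (T : measurableType d) (P : probability T R) (X : {RV P >-> R})
  (H : R -> R) : \bar R :=
  limf_einf (fun x : R => (hazard P X x / (H x)%:E)%E) +oo.
Arguments hazard_liminf {R d T} P X H.

Definition heavy (R : realType) (d : measure_display) (T : measurableType d)
  (P : probability T R) (H : R -> R) (X : {RV P >-> R}) : Prop :=
  right_unbounded P X /\ hazard_liminf P X H = 0%E.
Arguments heavy {R d T} P H X.

Definition light (R : realType) (d : measure_display) (T : measurableType d)
  (P : probability T R) (H : R -> R) (X : {RV P >-> R}) : Prop :=
  right_unbounded P X /\ (0 < hazard_liminf P X H)%E.
Arguments light {R d T} P H X.

Definition independent_rv (R : realType) (d : measure_display)
  (T : measurableType d) (P : probability T R) (X Y : {RV P >-> R}) : Prop :=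
  forall A B : set R, measurable A -> measurable B ->
    P (X @^-1` A `&` Y @^-1` B) = (P (X @^-1` A) * P (Y @^-1` B))%E.
Arguments independent_rv {R d T} P X Y.

(* Equality is only required on measurable sets: outside of them the values of
   a measure, as a total function on sets, are unspecified. *)
Definition same_distribution (R : realType) (d d' : measure_display)
  (T : measurableType d) (T' : measurableType d')
  (P : probability T R) (P' : probability T' R)
  (X : {RV P >-> R}) (X' : {RV P' >-> R}) : Prop :=
  forall A : set R, measurable A -> distribution P X A = distribution P' X' A.
Arguments same_distribution {R d d' T T'} P P' X X'.

Definition left_limit (R : realType) (H : R -> R) (x : R) : R :=
  lim (H y @[y --> x^'-]).

(* The points s_1 < t_1 < s_2 < ... are indexed from 0. *)
Definition segmentation (R : realType) (Hd Hu : R -> R) (s t : nat -> R) : Prop :=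
  [/\ forall i, s i < t i,
      forall i, t i < s i.+1,
      1 < Hd (s 0%N) &
      left_limit Hu (s i) / Hd (t i) @[i --> \oo] --> (0 : R)].

(* Main.v *)
Require Import Defs.
From HB Require Import structures.
From mathcomp Require Import all_boot all_order all_algebra.
From mathcomp Require Import all_classical all_reals all_analysis measurable_realfun.
From mathcomp Require Import ring lra.

Set Implicit Arguments.
Unset Strict Implicit.
Unset Printing Implicit Defensive.

Import Order.TTheory GRing.Theory Num.Theory.
Import numFieldNormedType.Exports.

Local Open Scope classical_set_scope.
Local Open Scope ring_scope.

(** Write r1 for the cumulative hazard of xi1. Tails of a minimum of independent
variables multiply, so hazards add, and everything becomes a question on
functions: can r1 be completed by a cumulative hazard r2 such that r2 is
infinitely often negligible against Hd, whereas r1 + r2 dominates a positive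
multiple of Hu near +oo?

From r2 to a segmentation ([segment_exists]). Let c * Hu <= r1 + r2 near +oo and
let t be a far point with r2 t much smaller than Hd t. Put v := (2 / c) * r2 t
and let s be the infimum of the points where Hu exceeds v. To the left of s, Hu
is at most v, so that the left limit of Hu at s is negligible against Hd t. On
[s, t], r2 is at most r2 t = (c / 2) * v, hence at most half of the required
c * Hu, and r1 has to supply the other half. As t runs to +oo so do
r2 t, v and s, and the segments can be picked one after the other.

From a segmentation to r2 ([complement_hazard_exists]). On a segment [s_i, t_i]
the function r1 already dominates Hu, so r2 may stay at the left limit of Hu at
s_i until t_i, where this value is negligible against Hd. So r2 is taken to be a
step function: it jumps, just after each t_i, to the left limit of Hu at
s_(i+1), which dominates Hu up to s_(i+1). A variable with hazard r2 exists
([hazard_realizable]) and the product space makes it independent of a copy of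
xi1 ([independent_coupling]).

Two features come from jumps. In the first direction s and t may coincide when
Hu jumps at t, so the segment is prolonged slightly beyond t. In the second one
r2 has to be right-continuous while still being small at t_i itself, so its jump
is delayed slightly. Both are harmless because Hu, being right-continuous, at
most doubles on a short interval to the right of t, where r1 does not
decrease. *)

(** * Limit inferior of a quotient at infinity *)

Lemma near_pinftyP (R : realType) (A : R -> Prop) :
  (\forall x \near +oo, A x) <-> exists M, forall x, M < x -> A x.
Proof.
by split=> [[M [_ MA]]|[M MA]]; [exists M | exists M; split=> //; exact: num_real].
Qed.

Lemma liminf_quotient_gt0P (R : realType) (f H : R -> R) :
  (forall x, 0 <= f x) -> (\forall x \near +oo, 0 < H x) ->
  (0 < limf_einf (fun x => ((f x)%:E / (H x)%:E)%E) +oo%R)%E <->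
  exists2 c, 0 < c & \forall x \near +oo, c * H x <= f x.
Proof.
move=> f0 /near_pinftyP[M0 H0]; rewrite limf_einfE; split.
  move=> /ereal_sup_gt[_ [V /near_pinftyP[M VM] <-]] inf0.
  have [c [c0 cV]] : exists c : R, 0 < c /\
      (c%:E <= ereal_inf [set ((f x)%:E / (H x)%:E)%E | x in V])%E.
    (* The infimum may be +oo, in which case any positive real bounds it. *)
    move: inf0; set m := ereal_inf _; case: m => [c c0|_|//].
      by exists c; rewrite lexx -lte_fin.
    by exists 1; rewrite ltr01 leey.
  exists c => //; apply/near_pinftyP; exists (Num.max M M0) => x.
  rewrite gt_max => /andP[Mx M0x].
  have : (c%:E <= (f x)%:E / (H x)%:E)%E.
    apply: (le_trans cV); apply: ge_ereal_inf.
    by exists ((f x)%:E / (H x)%:E)%E => //; exists x => //; exact: VM.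
  by rewrite inver gt_eqF ?H0// -EFinM lee_fin ler_pdivlMr ?H0.
move=> [c c0 /near_pinftyP[M cf]].
apply: (@lt_le_trans _ _ c%:E); first by rewrite lte_fin.
apply: le_ereal_sup_tmp.
exists (ereal_inf
  [set ((f x)%:E / (H x)%:E)%E | x in [set x | Num.max M M0 < x]]).
  exists [set x | Num.max M M0 < x] => //.
  by apply/near_pinftyP; exists (Num.max M M0).
apply: le_ereal_inf_tmp => _ [x /= Mx <-]; move: Mx; rewrite gt_max => /andP[Mx M0x].
by rewrite inver gt_eqF ?H0// -EFinM lee_fin ler_pdivlMr ?H0// cf.
Qed.

Lemma liminf_quotient_ge0 (R : realType) (f H : R -> R) :
  (forall x, 0 <= f x) -> (\forall x \near +oo, 0 < H x) ->
  (0 <= limf_einf (fun x => ((f x)%:E / (H x)%:E)%E) +oo%R)%E.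
Proof.
move=> f0 /near_pinftyP[M H0]; rewrite limf_einfE.
apply: le_ereal_sup_tmp.
exists (ereal_inf [set ((f x)%:E / (H x)%:E)%E | x in [set x | M < x]]).
  by exists [set x | M < x] => //; apply/near_pinftyP; exists M.
apply: le_ereal_inf_tmp => _ [x /= Mx <-].
by rewrite inver gt_eqF ?H0// -EFinM lee_fin divr_ge0// ltW// H0.
Qed.

Lemma liminf_quotient_eq0P (R : realType) (f H : R -> R) :
  (forall x, 0 <= f x) -> (\forall x \near +oo, 0 < H x) ->
  limf_einf (fun x => ((f x)%:E / (H x)%:E)%E) +oo%R = 0%E <->
  forall c M, 0 < c -> exists2 x, M < x & f x < c * H x.
Proof.
move=> f0 H0; have gt0P := liminf_quotient_gt0P f0 H0.
have ge0 := liminf_quotient_ge0 f0 H0.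
split=> [e0 c M c0|small].
  apply: contrapT => nsmall.
  suff : (0 < limf_einf (fun x => ((f x)%:E / (H x)%:E)%E) +oo%R)%E.
    by rewrite e0 ltxx.
  apply/gt0P; exists c => //; apply/near_pinftyP; exists M => x Mx.
  by rewrite leNgt; apply/negP => fx; apply: nsmall; exists x.
apply/eqP; rewrite eq_le ge0 andbT leNgt; apply/negP => /gt0P[c c0].
move=> /near_pinftyP[M cf]; have [x Mx] := small c M c0.
by rewrite ltNge cf.
Qed.

(** * Cumulative hazard functions *)

Section cumulative_hazard_theory.
Context (R : realType) (H : R -> R) (hH : cumulative_hazard H).

Lemma cumulative_hazard_gt_near (a : R) : \forall x \near +oo, a < H x.
Proof. by have /cvgryPgt/(_ a) := cumulative_hazard_y hH. Qed.

Lemma cumulative_hazard_gt_ex (a : R) : exists M, forall x, M <= x -> a < H x.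
Proof.
have /near_pinftyP[M HM] := cumulative_hazard_gt_near a.
exists (M + 1) => x Mx; apply: HM; lra.
Qed.

Lemma cumulative_hazard_is_cvg_left (x : R) : cvg (H y @[y --> x^'-]).
Proof.
apply: nondecreasing_at_left_is_cvgr; near=> y.
  by move=> u v _ _; exact: (cumulative_hazard_nd hH).
exists (H x) => _ [u /= + <-]; rewrite in_itv/= => /andP[_ /ltW ux].
exact: (cumulative_hazard_nd hH).
Unshelve. all: by end_near. Qed.

Lemma le_left_limit (x y : R) : x < y -> H x <= left_limit H y.
Proof.
move=> xy; apply: limr_ge; first exact: cumulative_hazard_is_cvg_left.
near=> z; apply: (cumulative_hazard_nd hH); apply: ltW.
by near: z; exact: nbhs_left_gt.
Unshelve. all: by end_near. Qed.

Lemma left_limit_le (a y : R) :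
  (forall x, x < y -> H x <= a) -> left_limit H y <= a.
Proof.
move=> Ha; apply: limr_le; first exact: cumulative_hazard_is_cvg_left.
near=> z; apply: Ha.
by near: z; exact: nbhs_left_lt.
Unshelve. all: by end_near. Qed.

Lemma left_limit_ge0 (y : R) : 0 <= left_limit H y.
Proof.
by apply: (le_trans (cumulative_hazard_ge0 hH (y - 1))); apply: le_left_limit; lra.
Qed.

Lemma left_limit_le_self (y : R) : left_limit H y <= H y.
Proof. by apply: left_limit_le => x /ltW; exact: (cumulative_hazard_nd hH). Qed.

(** Right-continuity in the form used to move an endpoint to the right: thanks
to monotonicity the strict bound holds on the whole half-line up to [y]. *)
Lemma cumulative_hazard_right_lt (x a u : R) : H x < a -> x < u ->
  exists2 y, x < y < u & forall z, z <= y -> H z < a.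
Proof.
move=> Hxa xu.
have : \forall y \near x^'+, x < y < u /\ H y < a.
  near=> y; split.
    apply/andP; split; near: y; [exact: nbhs_right_gt|exact: nbhs_right_lt].
  near: y; have := @cumulative_hazard_rc _ _ hH x.
  by move=> /cvgr_lt; apply.
move=> /filter_ex[y [xyu Hy]]; exists y => // z zy.
exact: le_lt_trans (cumulative_hazard_nd hH zy) Hy.
Unshelve. all: by end_near. Qed.

End cumulative_hazard_theory.

(** * From a complementary hazard to a segmentation *)

(** With [v := 2 / c * r2 t] for a far [t] where [r2 t] is tiny against [Hd t],
the left end of the segment is the generalized inverse of [Hu] at [v]: it is the
place from which half of [c * Hu] exceeds [r2 t], so that [r1] has to supply the
other half up to [t]. The constant drops from [c / 2] to [c / 4] because the
right end is moved slightly beyond [t], which guarantees [s < t] even if [Hu]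
jumps over [v] at [t]. *)
Lemma segment_exists (R : realType) (Hd Hu r1 r2 : R -> R) (c : R) :
  cumulative_hazard Hd -> cumulative_hazard Hu ->
  cumulative_hazard r1 -> cumulative_hazard r2 ->
  (\forall x \near +oo, Hd x <= Hu x) ->
  0 < c -> (\forall x \near +oo, c * Hu x <= r1 x + r2 x) ->
  (forall e M, 0 < e -> exists2 x, M < x & r2 x < e * Hd x) ->
  forall e M, 0 < e -> exists s t : R,
    [/\ M < s, s < t, 1 < Hd s, left_limit Hu s <= e * Hd t &
        forall x, s <= x <= t -> 0 < Hu x /\ c / 4 * Hu x <= r1 x].
Proof.
move=> hHd hHu h1 h2 /near_pinftyP[M1 dleu] c0 /near_pinftyP[M2 cu] small e M e0.
have [M3 HdM3] := cumulative_hazard_gt_ex hHd 1.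
pose N := Num.max (Num.max M M1) (Num.max M2 M3) + 1.
have [MN M1N M2N M3N] : [/\ M < N, M1 < N, M2 < N & M3 < N].
  by split; apply: le_lt_trans (ltr_pwDr ltr01 (lexx _));
    rewrite !le_max lexx ?orbT.
(* Beyond M4, the level v is at least Hu N, which forces s to lie beyond N. *)
have [M4 r2M4] := cumulative_hazard_gt_ex h2 (c / 2 * Hu N).
(* The factor c / 2 yields v < Hd t <= Hu t, the factor e * c / 2 yields
   v < e * Hd t. *)
pose e' := Num.min (c / 2) (e * c / 2).
have e'0 : 0 < e' by rewrite lt_min !divr_gt0// mulr_gt0.
have [t] := small e' (Num.max N M4) e'0.
rewrite gt_max => /andP[Nt M4t] r2t.
have Hdt : 1 < Hd t by apply: HdM3; apply: ltW; apply: lt_trans Nt.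
have r2t1 : r2 t < c / 2 * Hd t.
  by apply: lt_le_trans r2t _; rewrite ler_pM2r ?(lt_trans ltr01)// ge_min lexx.
have r2t2 : r2 t < e * c / 2 * Hd t.
  apply: lt_le_trans r2t _.
  by rewrite ler_pM2r ?(lt_trans ltr01)// ge_min lexx orbT.
have dut : Hd t <= Hu t by apply: dleu; apply: lt_trans Nt.
pose v := 2 / c * r2 t.
have vE : r2 t = c / 2 * v by rewrite /v; field; rewrite gt_eqF.
have vHd : v < Hd t by rewrite -(ltr_pM2l (_ : 0 < c / 2)) -?vE// divr_gt0.
have vHde : v < e * Hd t.
  by rewrite -(ltr_pM2l (_ : 0 < c / 2)) -?vE ?divr_gt0//; lra.
pose A := [set x | v < Hu x].
have At : A t by apply: lt_le_trans vHd dut.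
have NA x : A x -> N <= x.
  move=> Ax; rewrite leNgt; apply/negP => xN.
  have : c / 2 * v < c / 2 * Hu N.
    rewrite ltr_pM2l ?divr_gt0//; apply: lt_le_trans Ax _.
    exact/(cumulative_hazard_nd hHu)/ltW.
  by rewrite -vE ltNge => /negP; apply; apply: ltW; apply: r2M4; exact: ltW.
have hA : has_inf A by split; [exists t | exists N => x /NA].
pose s := inf A.
have Ns : N <= s by apply: lb_le_inf; [exists t | move=> x /NA].
have st : s <= t by apply: ge_inf => //; case: hA.
have below x : x < s -> Hu x <= v.
  move=> xs; rewrite leNgt; apply/negP => Ax.
  have : s <= x by apply: ge_inf => //; case: hA.
  by rewrite leNgt xs.
(* At s itself this uses the right-continuity of Hu. *)
have above x : s <= x -> v <= Hu x.
  move=> sx; apply: le_trans (cumulative_hazard_nd hHu sx).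
  rewrite leNgt; apply/negP => Hsv.
  have [y /andP[sy _] Hy] :=
    cumulative_hazard_right_lt hHu Hsv (ltr_pwDr ltr01 (lexx s)).
  have ys : 0 < y - s by rewrite subr_gt0.
  have [z Az zy] := inf_adherent ys hA.
  have zy' : z <= y by rewrite -/s in zy; lra.
  by have := Hy z zy'; rewrite ltNge (ltW Az).
have Hut : 0 < Hu t by lra.
have [t' /andP[tt' _] Hut'] :
  exists2 y, t < y < t + 1 & forall z, z <= y -> Hu z < 2 * Hu t.
  by apply: cumulative_hazard_right_lt => //; lra.
exists s, t'; split.
- exact: lt_le_trans Ns.
- exact: le_lt_trans tt'.
- by apply: HdM3; apply: ltW; apply: lt_le_trans Ns.
- apply: (@le_trans _ _ v); first exact: left_limit_le.
  apply: (le_trans (ltW vHde)); rewrite ler_pM2l//.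
  exact/(cumulative_hazard_nd hHd)/ltW.
- move=> x /andP[sx xt'].
  have Nx : N <= x by exact: le_trans sx.
  have Hux : 0 < Hu x.
    apply: lt_le_trans (dleu x (lt_le_trans M1N Nx)).
    by apply: lt_trans ltr01 _; apply: HdM3; apply: ltW; exact: lt_le_trans Nx.
  have good y : s <= y -> y <= t -> c / 2 * Hu y <= r1 y.
    move=> sy yt; have Ny := le_trans Ns sy.
    have cuy := cu y (lt_le_trans M2N Ny).
    have r2y := cumulative_hazard_nd h2 yt.
    have : c / 2 * v <= c / 2 * Hu y by rewrite ler_pM2l ?divr_gt0// above.
    by rewrite -vE; lra.
  split=> //; have [xt|tx] := leP x t.
    by apply: le_trans (good x sx xt); rewrite ler_pM2r//; lra.
  apply: le_trans (cumulative_hazard_nd h1 (ltW tx)).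
  apply: le_trans (good t st (lexx t)).
  rewrite [leRHS](_ : _ = c / 4 * (2 * Hu t)); last by lra.
  by rewrite ler_pM2l ?divr_gt0// ltW// Hut'.
Qed.

(** The segments are chosen recursively, each beyond the previous one, the
[i]-th with the tolerance [1 / (i + 1)]. *)
Lemma segmentation_exists (R : realType) (Hd Hu r1 r2 : R -> R) (c : R) :
  cumulative_hazard Hd -> cumulative_hazard Hu ->
  cumulative_hazard r1 -> cumulative_hazard r2 ->
  (\forall x \near +oo, Hd x <= Hu x) ->
  0 < c -> (\forall x \near +oo, c * Hu x <= r1 x + r2 x) ->
  (forall e M, 0 < e -> exists2 x, M < x & r2 x < e * Hd x) ->
  exists s t : nat -> R, segmentation Hd Hu s t /\
    forall i x, s i <= x <= t i -> 0 < Hu x /\ c / 4 * Hu x <= r1 x.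
Proof.
move=> hHd hHu h1 h2 dleu c0 cu small.
have next (nM : nat * R) : exists st : R * R,
    [/\ nM.2 < st.1, st.1 < st.2, 1 < Hd st.1,
      left_limit Hu st.1 <= harmonic nM.1 * Hd st.2 &
      forall x, st.1 <= x <= st.2 -> 0 < Hu x /\ c / 4 * Hu x <= r1 x].
  have [s [t st]] := segment_exists hHd hHu h1 h2 dleu c0 cu small nM.2
    (harmonic_gt0 nM.1).
  by exists (s, t).
have [f fP] := choice next.
pose st := fix st n := if n is k.+1 then f (n, (st k).2) else f (0%N, 0).
have stP n : exists M, st n = f (n, M) by case: n => [|n]; eexists.
exists (fst \o st), (snd \o st); split; last first.
  by move=> i x /=; have [M ->] := stP i; have [_ _ _ _] := fP (i, M); exact.
split=> /=.
- by move=> i; have [M ->] := stP i; have [] := fP (i, M).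
- by move=> i; have [] := fP (i.+1, (st i).2).
- by have [] := fP (0%N, 0).
apply: (squeeze_cvgr _ (cvg_cst 0) cvg_harmonic).
near=> i; rewrite /=; have [M ->] := stP i.
have [_ lt_st Hs /= le_e _] := fP (i, M).
have Ht : 0 < Hd (f (i, M)).2.
  apply: lt_le_trans ltr01 (le_trans (ltW Hs) _).
  exact/(cumulative_hazard_nd hHd)/ltW.
by rewrite divr_ge0 ?left_limit_ge0 ?(ltW Ht)//= ler_pdivrMr.
Unshelve. all: by end_near. Qed.

(** * From a segmentation to a complementary hazard *)

(** The prescribed values leave the function free to the left of [u 0]; it
vanishes there, as the limit at -oo demands. *)
Lemma step_hazard_exists (R : realType) (u b : nat -> R) :
  (forall i, u i < u i.+1) -> (forall x, exists i, x < u i) ->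
  (forall i, 0 <= b i) -> (forall i, b i <= b i.+1) ->
  (forall A, exists i, A <= b i) ->
  exists2 h : R -> R, cumulative_hazard h &
    forall i x, u i <= x < u i.+1 -> h x = b i.
Proof.
move=> uS uy b0 bS by_.
(* N x is the number of the thresholds u that are at most x. *)
pose N x := ex_minn (uy x).
have ltN x : x < u (N x) by rewrite /N; case: ex_minnP.
have Nle x i : x < u i -> (N x <= i)%N.
  by rewrite /N; case: ex_minnP => m _ + xi; apply.
have ltu i j : (i <= j)%N -> u i <= u j.
  by move: i j; apply/nondecreasing_seqP => k; exact: ltW.
have leN i x : u i <= x -> (i < N x)%N.
  move=> ix; rewrite ltnNge; apply/negP => /ltu Ni.
  by have := lt_le_trans (ltN x) (le_trans Ni ix); rewrite ltxx.
pose a i := if i is k.+1 then b k else 0.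
have ale : {homo a : i j / (i <= j)%N >-> i <= j}.
  by apply/nondecreasing_seqP; case=> [|i] /=.
exists (a \o N) => [|i x /andP[ix xi] /=]; last first.
  by have /eqP -> : N x == i.+1 by rewrite eqn_leq leN ?Nle.
split=> /=.
- by move=> x; exact: (ale 0%N).
- by move=> x y xy; apply/ale/Nle; exact: le_lt_trans (ltN y).
- move=> x; apply: cvg_near_cst; near=> y => /=; congr a.
  have xy : x < y by near: y; exact: nbhs_right_gt.
  have yN : y < u (N x) by near: y; exact: nbhs_right_lt (ltN x).
  apply/eqP; rewrite eqn_leq Nle//= Nle//.
  exact: lt_trans (ltN y).
- apply: cvg_near_cst; near=> x.
  have : x < u 0%N by near: x; apply: nbhs_ninfty_lt; exact: num_real.
  by move/Nle; rewrite leqn0 /= => /eqP ->.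
- apply/cvgryPge => A; have [i Ai] := by_ A.
  near=> x; apply: (le_trans Ai); rewrite -[b i]/(a i.+1); apply/ale/leN.
  by near: x; apply: nbhs_pinfty_ge; exact: num_real.
Unshelve. all: by end_near. Qed.

(** The step function jumps at points [u i] slightly to the right of [t i], to
the left limit of [Hu] at [s i.+1]. At [t i.+1] it still has this value, which
is negligible against [Hd (t i.+1)]. It dominates [Hu] between [u i] and
[s i.+1]; from there to [u i.+1] the given lower bound on [r1] takes over, with
half the constant beyond [t i.+1]. *)
Lemma complement_hazard_exists (R : realType) (Hd Hu r1 : R -> R)
  (s t : nat -> R) (g : R) :
  cumulative_hazard Hd -> cumulative_hazard Hu -> cumulative_hazard r1 ->
  0 < g -> segmentation Hd Hu s t ->
  (forall i x, s i <= x <= t i -> 0 < Hu x /\ g * Hu x <= r1 x) ->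
  exists r2, [/\ cumulative_hazard r2,
    forall e M, 0 < e -> exists2 x, M < x & r2 x < e * Hd x &
    exists2 c, 0 < c & \forall x \near +oo, c * Hu x <= r1 x + r2 x].
Proof.
move=> hHd hHu h1 g0 [ltst ltts Hs1 lim0] good.
have Hut i : 0 < Hu (t i) by apply: (good i _ _).1; rewrite lexx ltW.
have ts i j : (i < j)%N -> t i < s j.
  elim: j => // j IHj; rewrite ltnS leq_eqVlt => /predU1P[->//|/IHj ij].
  exact: lt_trans ij (lt_trans (ltst j) (ltts j)).
have tt i j : (i <= j)%N -> t i <= t j.
  rewrite leq_eqVlt => /predU1P[->//|/ts ij].
  exact: ltW (lt_trans ij (ltst j)).
have Hdt i : 1 < Hd (t i).
  apply: lt_le_trans Hs1 _; apply: (cumulative_hazard_nd hHd).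
  by apply: le_trans (ltW (ltst 0%N)) _; exact: tt.
have small e : 0 < e -> \forall i \near \oo, left_limit Hu (s i) < e * Hd (t i).
  move=> e0; have /cvgr_lt/(_ _ e0) := lim0; apply: filterS => i.
  by rewrite ltr_pdivrMr// (lt_trans ltr01).
(* If t were bounded, Hd (t i) would be bounded whereas the left limits at s i
   stay above Hu (t 0) > 0, so that their quotient could not vanish. *)
have ty M : exists i, M < t i.
  apply: contrapT => /forallNP tM.
  have HdM i : Hd (t i) <= Hd M.
    by apply: (cumulative_hazard_nd hHd); rewrite leNgt; apply/negP/tM.
  have HM0 : 0 < Hd M by apply: lt_le_trans (HdM 0%N); apply: lt_trans ltr01 _.
  have [i [/= i0]] : exists i, (0 < i)%N /\
      left_limit Hu (s i) < Hu (t 0%N) / Hd M * Hd (t i).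
    apply: (@filter_ex _ \oo); near=> i; split; near: i.
      exact: nbhs_infty_gt.
    by apply: small; rewrite divr_gt0.
  rewrite ltNge => /negP; apply.
  apply: (@le_trans _ _ (Hu (t 0%N))); last exact/le_left_limit/ts.
  by rewrite -mulrA ger_pMr// mulrC ler_pdivrMr// mul1r.
have uP i : exists u,
    [/\ t i < u, u < s i.+1 & forall x, x <= u -> Hu x < 2 * Hu (t i)].
  have Hu2 : Hu (t i) < 2 * Hu (t i) by have := Hut i; lra.
  have [u /andP[tu us] uH] := cumulative_hazard_right_lt hHu Hu2 (ltts i).
  by exists u.
have [u {}uP] := choice uP.
have tu i : t i < u i by have [] := uP i.
have us i : u i < s i.+1 by have [] := uP i.
have uH i x : x <= u i -> Hu x < 2 * Hu (t i) by have [_ _] := uP i; apply.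
pose b i := left_limit Hu (s i.+1).
have uS i : u i < u i.+1 := lt_trans (us i) (lt_trans (ltst i.+1) (tu i.+1)).
have uy x : exists i, x < u i by have [i /lt_trans xi] := ty x; exists i; exact: xi.
have bS i : b i <= b i.+1.
  apply: (le_trans (left_limit_le_self hHu _)); apply: (le_left_limit hHu).
  exact: lt_trans (ltst _) (ltts _).
have by_ A : exists i, A <= b i.
  have [M HM] := cumulative_hazard_gt_ex hHu A.
  have [i Mi] := ty M; exists i; apply: (@le_trans _ _ (Hu (t i))).
    by apply/ltW/HM/ltW.
  exact: le_left_limit.
have [r2 h2 r2E] :=
  step_hazard_exists uS uy (fun i => left_limit_ge0 hHu _) bS by_.
exists r2; split=> //.
  move=> e M e0; have [j Mj] := ty M.
  have [i [/= ij ei]] : exists i, (j <= i)%N /\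
      left_limit Hu (s i.+1) < e * Hd (t i.+1).
    apply: (@filter_ex _ \oo); near=> i; split; near: i.
      exact: nbhs_infty_ge.
    have [k _ kP] := small e e0; exists k => // i /= ki.
    by apply: kP => /=; exact: leqW.
  exists (t i.+1); first by apply: lt_le_trans Mj _; apply: tt; exact: leqW.
  by rewrite (r2E i)// (ltW (lt_trans (us i) (ltst i.+1))) tu.
exists (Num.min 1 (g / 2)); first by rewrite lt_min ltr01 divr_gt0.
set c := Num.min _ _.
have c1 : c <= 1 by rewrite ge_min lexx.
have cg : c <= g / 2 by rewrite ge_min lexx orbT.
near=> x.
have u0x : u 0%N <= x by near: x; apply: nbhs_pinfty_ge; exact: num_real.
have [i /andP[ix xi]] : exists i, u i <= x < u i.+1.
  have := uy x; case/ex_minnP => -[|i] xi imin.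
    by move: xi; rewrite ltNge u0x.
  by exists i; rewrite xi andbT leNgt; apply/negP => /imin; rewrite ltnn.
have r1x := cumulative_hazard_ge0 h1 x.
have Hux := cumulative_hazard_ge0 hHu x.
have r2x := cumulative_hazard_ge0 h2 x.
have [xs|sx] := ltP x (s i.+1).
  have : c * Hu x <= 1 * Hu x by rewrite ler_wpM2r.
  have := le_left_limit hHu xs; rewrite (r2E i x) ?ix// /b; lra.
suff : g / 2 * Hu x <= r1 x.
  have : c * Hu x <= g / 2 * Hu x by rewrite ler_wpM2r.
  lra.
have [xt|tx] := leP x (t i.+1).
  have [|_] := good i.+1 x; first by rewrite sx xt.
  have : 0 <= g * Hu x by rewrite mulr_ge0// ltW.
  lra.
have [|_ gt] := good i.+1 (t i.+1); first by rewrite lexx ltW.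
have := cumulative_hazard_nd h1 (ltW tx).
have : g * Hu x <= g * (2 * Hu (t i.+1)) by rewrite ler_pM2l// ltW// uH// ltW.
lra.
Unshelve. all: by end_near. Qed.

(** * Hazards of random variables *)

Section hazard_theory.
Context (R : realType) (d : measure_display) (T : measurableType d).
Context (P : probability T R).
Implicit Types X Y : {RV P >-> R}.

Lemma ccdfE X x : ccdf X x = P [set w | x < X w].
Proof.
rewrite /ccdf /distribution /pushforward; congr (P _).
by apply/seteqP; split=> w /=; rewrite in_itv/= andbT.
Qed.

Lemma ccdf_fin_num X x : ccdf X x \is a fin_num.
Proof. by rewrite fin_num_measure. Qed.

Lemma hazard_fin X x : (0 < ccdf X x)%E ->
  hazard P X x = (- ln (fine (ccdf X x)))%:E.
Proof.
move=> X0; rewrite /hazard -[in LHS](fineK (ccdf_fin_num X x)).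
by rewrite lne_EFin// fine_gt0// X0 ltey_eq ccdf_fin_num.
Qed.

Lemma right_unbounded_ccdf X : right_unbounded P X <-> forall x, (0 < ccdf X x)%E.
Proof. by split=> h x; have := h x; rewrite ccdfE. Qed.

(** The bridge from random variables to real functions: for a right-unbounded
variable the extended-real valued hazard is finite everywhere. *)
Lemma right_unbounded_hazard X : right_unbounded P X ->
  cumulative_hazard (fun x => fine (hazard P X x)) /\
  forall x, hazard P X x = (fine (hazard P X x))%:E.
Proof.
move=> /right_unbounded_ccdf X0; split=> [|x]; last by rewrite hazard_fin.
have -> : (fun x => fine (hazard P X x)) = (fun x => - ln (fine (ccdf X x))).
  by apply/funext => x; rewrite hazard_fin.
have fX x : ccdf X x = (fine (ccdf X x))%:E by rewrite fineK// ccdf_fin_num.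
have X0' x : 0 < fine (ccdf X x) by rewrite -lte_fin -fX.
split.
- move=> x; rewrite oppr_ge0 ln_le0// -lee_fin -fX.
  exact: probability_le1.
- move=> x y xy; rewrite lerN2 ler_ln ?posrE//.
  by rewrite -lee_fin -!fX; exact: ccdf_nonincreasing.
- move=> x; apply: cvgN; apply: continuous_cvg; first exact: continuous_ln.
  by apply: fine_cvg; rewrite -fX; exact: ccdf_right_continuous.
- rewrite -oppr0 -(@ln1 R); apply: cvgN.
  apply: continuous_cvg; first exact: continuous_ln.
  by apply: fine_cvg; exact: cvg_ccdfNy1.
- apply/cvgryPgt => A.
  have : \forall x \near +oo, fine (ccdf X x) < expR (- A).
    have : fine (ccdf X x) @[x --> +oo] --> 0 by apply: fine_cvg; exact: cvg_ccdfy0.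
    by move=> /cvgr_lt; apply; exact: expR_gt0.
  apply: filterS => x xA; rewrite ltrNr -(expRK (- A)) ltr_ln ?posrE//.
  exact: expR_gt0.
Qed.

Lemma hazard_min X Y x : independent_rv P X Y ->
  right_unbounded P X -> right_unbounded P Y ->
  hazard P (X \min Y : {RV P >-> R}) x = (hazard P X x + hazard P Y x)%E.
Proof.
move=> XY /right_unbounded_ccdf X0 /right_unbounded_ccdf Y0.
have ccdfM : ccdf (X \min Y : {RV P >-> R}) x = (ccdf X x * ccdf Y x)%E.
  rewrite [RHS](_ : _ = P (X @^-1` `]x, +oo[ `&` Y @^-1` `]x, +oo[));
    last by rewrite XY.
  rewrite ccdfE; congr (P _).
  apply/seteqP; split=> w /=; rewrite !in_itv/= !andbT lt_min; first by move/andP.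
  by move=> [-> ->].
rewrite /hazard ccdfM lneM ?in_itv/= ?X0 ?Y0 ?leey//.
rewrite oppeD// -[ccdf X x]fineK ?ccdf_fin_num// lne_EFin//.
by rewrite fine_gt0// X0 ltey_eq ccdf_fin_num.
Qed.

End hazard_theory.

Lemma same_distribution_hazard (R : realType) (d d' : measure_display)
  (T : measurableType d) (T' : measurableType d')
  (P : probability T R) (P' : probability T' R)
  (X : {RV P >-> R}) (X' : {RV P' >-> R}) :
  same_distribution P P' X X' -> hazard P X = hazard P' X'.
Proof. by move=> XX'; apply/funext => x; rewrite /hazard /ccdf XX'. Qed.

Lemma hazard_right_unbounded (R : realType) (d : measure_display)
  (T : measurableType d) (P : probability T R) (X : {RV P >-> R}) (h : R -> R) :
  hazard P X = EFin \o h -> right_unbounded P X.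
Proof.
move=> Xh; apply/right_unbounded_ccdf => x; rewrite ltNge; apply/negP => X0.
by have := congr1 (@^~ x) Xh; rewrite /hazard /= le0_lneNy.
Qed.

(** [1 - expR (- h)] is the distribution function of a Lebesgue-Stieltjes
probability, under which the identity has hazard [h]. *)
Lemma hazard_realizable (R : realType) (h : R -> R) : cumulative_hazard h ->
  exists (P : probability (measurableTypeR R) R) (X : {RV P >-> R}),
    hazard P X = EFin \o h.
Proof.
move=> hh; pose F x : R := 1 - expR (- h x).
have Fnd : nondecreasing F.
  move=> x y xy; rewrite lerD2l lerN2 ler_expR lerN2.
  exact: (cumulative_hazard_nd hh).
have Frc : right_continuous F.
  move=> x; apply: cvgB; first exact: cvg_cst.
  apply: continuous_cvg; first exact: continuous_expR.
  by apply: cvgN; exact: (cumulative_hazard_rc hh).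
have FNy : F @ -oo --> (0 : R).
  rewrite [X in _ --> X](_ : _ = 1 - expR (- 0));
    last by rewrite oppr0 expR0 subrr.
  apply: cvgB; first exact: cvg_cst.
  apply: continuous_cvg; first exact: continuous_expR.
  by apply: cvgN; exact: (cumulative_hazard_Ny hh).
have Fy : F @ +oo --> (1 : R).
  rewrite [X in _ --> X](_ : _ = 1 - 0 :> R); last by rewrite subr0.
  apply: cvgB; first exact: cvg_cst.
  exact: (cvg_comp _ _ (cumulative_hazard_y hh) (@cvgr_expR R)).
pose c0 := isCumulative.Build R _ R F Fnd Frc.
pose c1 := isCumulativeBounded.Build R 0 1 F FNy Fy.
pose FF : cumulativeBounded (0 : R) (1 : R) := HB.pack F c0 c1.
pose X0 : measurableTypeR R -> R := idfun.
pose mX := @isMeasurableFun.Build _ _ _ _ X0 (@measurable_id _ _ setT).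
pose X : {mfun measurableTypeR R >-> R} := HB.pack X0 mX.
exists (lebesgue_stieltjes_measure FF), X.
apply/funext => x.
have XF : cdf (X : {RV (lebesgue_stieltjes_measure FF) >-> R}) x = (F x)%:E.
  exact: (cdf_lebesgue_stieltjes_id FF x).
by rewrite /hazard ccdf_1_cdf XF -EFinB subKr lne_EFin ?expR_gt0// expRK /= opprK.
Qed.

Lemma independent_coupling (R : realType) (d d' : measure_display)
  (T : measurableType d) (T' : measurableType d')
  (P : probability T R) (P' : probability T' R)
  (X : {RV P >-> R}) (X' : {RV P' >-> R}) :
  exists (Q : probability (T * T')%type R) (Y Y' : {RV Q >-> R}),
    [/\ same_distribution P Q X Y, same_distribution P' Q X' Y' &
        independent_rv Q Y Y'].
Proof.
have mY : measurable_fun setT (X \o @fst T T') by exact: measurableT_comp.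
have mY' : measurable_fun setT (X' \o @snd T T') by exact: measurableT_comp.
pose Y : {mfun (T * T')%type >-> R} := mfun_Sub (mem_set mY).
pose Y' : {mfun (T * T')%type >-> R} := mfun_Sub (mem_set mY').
have QE A A' : measurable A -> measurable A' ->
    (P \x P')%E (X @^-1` A `*` X' @^-1` A') =
    (P (X @^-1` A) * P' (X' @^-1` A'))%E.
  move=> mA mA'; apply: product_measure1E; exact: measurable_funPTI.
have QY A : measurable A -> (P \x P')%E (Y @^-1` A) = P (X @^-1` A).
  move=> mA; have := QE A setT mA measurableT.
  rewrite preimage_setT probability_setT mule1 => <-; congr (_ _).
  by apply/seteqP; split=> [w ?|w []].
have QY' A : measurable A -> (P \x P')%E (Y' @^-1` A) = P' (X' @^-1` A).
  move=> mA; have := QE setT A measurableT mA.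
  rewrite preimage_setT probability_setT mul1e => <-; congr (_ _).
  by apply/seteqP; split=> [w ?|w []].
exists (P \x P')%E, Y, Y'; split=> [A mA|A mA|A A' mA mA'].
- by rewrite /distribution /pushforward -QY.
- by rewrite /distribution /pushforward -QY'.
- exact: etrans (QE A A' mA mA') (esym (congr2 mule (QY A mA) (QY' A' mA'))).
Qed.

(** * Heavy and light variables *)

Lemma heavyP (R : realType) (d : measure_display) (T : measurableType d)
  (P : probability T R) (H h : R -> R) (X : {RV P >-> R}) :
  cumulative_hazard H -> (forall x, 0 <= h x) -> hazard P X = EFin \o h ->
  heavy P H X <-> forall e M, 0 < e -> exists2 x, M < x & h x < e * H x.
Proof.
move=> hH h0 Xh.
have eq0P := liminf_quotient_eq0P h0 (cumulative_hazard_gt_near hH 0).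
rewrite /heavy /hazard_liminf Xh; split=> [[_ /eq0P//]|/eq0P liminf0].
by split=> //; exact: hazard_right_unbounded Xh.
Qed.

Lemma lightP (R : realType) (d : measure_display) (T : measurableType d)
  (P : probability T R) (H h : R -> R) (X : {RV P >-> R}) :
  cumulative_hazard H -> (forall x, 0 <= h x) -> hazard P X = EFin \o h ->
  light P H X <-> exists2 c, 0 < c & \forall x \near +oo, c * H x <= h x.
Proof.
move=> hH h0 Xh.
have gt0P := liminf_quotient_gt0P h0 (cumulative_hazard_gt_near hH 0).
rewrite /light /hazard_liminf Xh; split=> [[_ /gt0P//]|/gt0P liminf0].
by split=> //; exact: hazard_right_unbounded Xh.
Qed.

Theorem theorem1p9 (R : realType) (Hd Hu : R -> R)
  (hHd : cumulative_hazard Hd) (hHu : cumulative_hazard Hu)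
  (hle : exists x0 : R, forall x : R, x0 <= x -> Hd x <= Hu x)
  (d : measure_display) (T : measurableType d) (P : probability T R)
  (xi1 : {RV P >-> R}) (hxi1 : heavy P Hd xi1) :
  (exists (d' : measure_display) (T' : measurableType d')
     (P' : probability T' R) (xi1' xi2 : {RV P' >-> R}),
     [/\ same_distribution P P' xi1 xi1',
         heavy P' Hd xi2,
         independent_rv P' xi1' xi2 &
         light P' Hu (xi1' \min xi2 : {RV P' >-> R})])
  <->
  (exists (gamma : R) (s t : nat -> R),
     [/\ 0 < gamma,
         segmentation Hd Hu s t &
         forall (i : nat) (x : R), s i <= x <= t i ->
           0 < Hu x /\ (gamma%:E <= hazard P xi1 x / (Hu x)%:E)%E]).
Proof.
have [h1 xi1E] := right_unbounded_hazard hxi1.1.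
set r1 := fun x => fine (hazard P xi1 x) in h1.
have {}xi1E : hazard P xi1 = EFin \o r1 by apply/funext.
have quotientP g x : 0 < Hu x ->
    (g%:E <= hazard P xi1 x / (Hu x)%:E)%E = (g * Hu x <= r1 x).
  by move=> Hx; rewrite xi1E /= inver gt_eqF// -EFinM lee_fin ler_pdivlMr.
have minE d' (T' : measurableType d') (P' : probability T' R)
    (X Y : {RV P' >-> R}) (r2 : R -> R) :
    independent_rv P' X Y ->
    hazard P' X = EFin \o r1 -> hazard P' Y = EFin \o r2 ->
    hazard P' (X \min Y : {RV P' >-> R}) = EFin \o (fun x => r1 x + r2 x).
  move=> XY Xr1 Yr2; apply/funext => x; rewrite hazard_min//.
  - by rewrite Xr1 Yr2.
  - exact: hazard_right_unbounded Xr1.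
  - exact: hazard_right_unbounded Yr2.
split=> [[d' [T' [P' [X [Y [eqX heavyY XY lightXY]]]]]]|[g [s [t [g0 seg good]]]]].
  have XE : hazard P' X = EFin \o r1 by rewrite -xi1E (same_distribution_hazard eqX).
  have [h2 YE] := right_unbounded_hazard heavyY.1.
  set r2 := fun x => fine (hazard P' Y x) in h2.
  have {}YE : hazard P' Y = EFin \o r2 by apply/funext.
  have r0 x : 0 <= r1 x + r2 x.
    by rewrite addr_ge0// ?(cumulative_hazard_ge0 h1) ?(cumulative_hazard_ge0 h2).
  have /(lightP hHu r0 (minE _ _ _ _ _ _ XY XE YE)) [c c0 cu] := lightXY.
  have /(heavyP hHd (cumulative_hazard_ge0 h2) YE) small := heavyY.
  have dleu : \forall x \near +oo, Hd x <= Hu x.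
    by have [x0 x0P] := hle; apply/near_pinftyP; exists x0 => x /ltW/x0P.
  have [s [t [seg good]]] := segmentation_exists hHd hHu h1 h2 dleu c0 cu small.
  exists (c / 4), s, t; split=> // [|i x /good[Hx le_r1]]; first by rewrite divr_gt0.
  by rewrite quotientP.
have good' i x : s i <= x <= t i -> 0 < Hu x /\ g * Hu x <= r1 x.
  by move=> /good[Hx]; rewrite quotientP.
have [r2 [h2 small [c c0 cu]]] := complement_hazard_exists hHd hHu h1 g0 seg good'.
have [P2 [Y2 Y2E]] := hazard_realizable h2.
have [Q [X [Y [eqX eqY XY]]]] := independent_coupling xi1 Y2.
have XE : hazard Q X = EFin \o r1 by rewrite -xi1E (same_distribution_hazard eqX).
have YE : hazard Q Y = EFin \o r2 by rewrite -Y2E (same_distribution_hazard eqY).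
exists _, _, Q, X, Y; split=> //.
  by apply/(heavyP hHd (cumulative_hazard_ge0 h2) YE).
apply/(lightP hHu _ (minE _ _ _ _ _ _ XY XE YE)); last by exists c.
by move=> x; rewrite addr_ge0// ?(cumulative_hazard_ge0 h1) ?(cumulative_hazard_ge0 h2).
Qed.
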